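(* Let $\Gamma$ be a connected strongly regular graph with parameters $(v,k,\lambda,\mu)$, with Laplacian $L$ whose two distinct nonzero eigenvalues $r$ and $s$ (with multiplicities $f$ and $g$) are integers. Let $p$ be a prime dividing $|K(\Gamma)|$, let $K_p(\Gamma)$ be the Sylow $p$-subgroup of the critical group $K(\Gamma)$, and let $e_0$ be the $p$-rank of $L$. Suppose $p \parallel r$ and $p^2 \parallel s$, and let $\gamma$ be the nonnegative integer with $p^\gamma \parallel v$. Then either \[ K_p(\Gamma) \cong (\mathbb{Z}/p\mathbb{Z})^{f-e_0} \oplus (\mathbb{Z}/p^2\mathbb{Z})^{g+\gamma-e_0} \oplus (\mathbb{Z}/p^3\mathbb{Z})^{e_0-\gamma} \] or \[ K_p(\Gamma) \cong (\mathbb{Z}/p\mathbb{Z})^{f+1-e_0} \oplus (\mathbb{Z}/p^2\mathbb{Z})^{g+\gamma-2-e_0} \oplus (\mathbb{Z}/p^3\mathbb{Z})^{e_0-\gamma+1}. \] Furthermore, if $\gamma = 0$ then \[ K_p(\Gamma) \cong (\mathbb{Z}/p\mathbb{Z})^{f-e_0} \oplus (\mathbb{Z}/p^2\mathbb{Z})^{g-e_0} \oplus (\mathbb{Z}/p^3\mathbb{Z})^{e_0}. \] The same statement holds with the roles of $r$ and $s$ interchanged and the roles of $f$ and $g$ interchanged.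
   Context: A graph is strongly regular with parameters $(v,k,\lambda,\mu)$ if it has $v$ vertices, is $k$-regular, any two adjacent vertices have exactly $\lambda$ common neighbours, and any two non-adjacent vertices have exactly $\mu$ common neighbours. The Laplacian is $L = kI - A$, where $A$ is the adjacency matrix; $0$ is an eigenvalue of $L$ of multiplicity one and $L$ has exactly two other distinct eigenvalues $r,s$, with multiplicities $f,g$. Viewing $L$ as a map $\mathbb{Z}^{\mathcal{V}} \to \mathbb{Z}^{\mathcal{V}}$, its cokernel decomposes as $K(\Gamma) \oplus \mathbb{Z}$ with $K(\Gamma)$ finite abelian; $K(\Gamma)$ is the critical group. The $p$-rank of $L$ is its rank over the field with $p$ elements. $p^a \parallel n$ means $p^a \mid n$ and $p^{a+1} \nmid n$. *)

(* Defs.v *)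
From HB Require Import structures.
From mathcomp Require Import all_boot all_order all_algebra.
Set Implicit Arguments.
Unset Strict Implicit.
Unset Printing Implicit Defensive.
Import Order.TTheory GRing.Theory Num.Theory.
Local Open Scope ring_scope.

Definition simple_graph n (e : rel 'I_n) : Prop :=
  (forall i j, e i j = e j i) /\ (forall i, ~~ e i i).

Definition srg n (e : rel 'I_n) (v k lam mu : nat) : Prop :=
  [/\ simple_graph e, n = v,
      (forall i, #|[set j | e i j]| = k),
      (forall i j, i != j -> e i j -> #|[set l | e i l && e j l]| = lam) &
      (forall i j, i != j -> ~~ e i j -> #|[set l | e i l && e j l]| = mu)].

Definition connected_graph n (e : rel 'I_n) : Prop :=
  forall i j, connect e i j.

Definition adjmx n (e : rel 'I_n) : 'M[int]_n := \matrix_(i, j) (e i j)%:R.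

Definition laplacian n (e : rel 'I_n) (k : nat) : 'M[int]_n :=
  (k%:Z)%:M - adjmx e.

Definition prank n (p : nat) (L : 'M[int]_n) : nat :=
  \rank (map_mx (fun z : int => (z%:~R : 'F_p)) L).

Definition pexact (p a m : nat) : bool := (p ^ a %| m)%N && ~~ (p ^ a.+1 %| m)%N.

(* x lies in the image L Z^V (rows of the symmetric L span the image) *)
Definition inImL n (L : 'M[int]_n) (x : 'rV[int]_n) : Prop :=
  exists y : 'rV[int]_n, x = y *m L.

(* The subgroup {x | P x} / L Z^V of coker L = Z^V / L Z^V is isomorphic
   to the abelian group G: psi : G -> Z^V is (a lift of) an injective additive
   map G -> coker L whose image is exactly the classes of the x with P x. *)
Definition coker_sub_iso n (L : 'M[int]_n) (P : 'rV[int]_n -> Prop)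
    (G : zmodType) : Prop :=
  exists psi : G -> 'rV[int]_n,
    [/\ (forall a b, inImL L (psi (a + b) - psi a - psi b)),
        (forall a, inImL L (psi a) -> a = 0) &
        (forall x, P x <-> exists a, inImL L (x - psi a))].

(* torsion of coker L: this is the critical group K(Gamma) (coker L = K ⊕ Z) *)
Definition torsK n (L : 'M[int]_n) (x : 'rV[int]_n) : Prop :=
  exists m : nat, (0 < m)%N /\ inImL L (x *+ m).

(* p-primary torsion of coker L: the Sylow p-subgroup K_p(Gamma) *)
Definition ptorsK n (p : nat) (L : 'M[int]_n) (x : 'rV[int]_n) : Prop :=
  exists j : nat, inImL L (x *+ (p ^ j)).

(* (Z/pZ)^a ⊕ (Z/p^2Z)^b ⊕ (Z/p^3Z)^c  (p prime, so p, p^2, p^3 >= 2) *)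
Definition Gp (p a b c : nat) : zmodType :=
  ({ffun 'I_a -> 'Z_(p ^ 1)} * {ffun 'I_b -> 'Z_(p ^ 2)} *
   {ffun 'I_c -> 'Z_(p ^ 3)})%type.

Definition Kp_iso n (p : nat) (L : 'M[int]_n) (a b c : int) : Prop :=
  exists a' b' c' : nat,
    [/\ a = a'%:Z, b = b'%:Z, c = c'%:Z &
        coker_sub_iso L (ptorsK p L) (Gp p a' b' c')].

(* Main.v *)
Require Import Defs.
From HB Require Import structures.
From mathcomp Require Import all_boot all_order all_algebra.
From mathcomp Require Import zify ring.
Set Implicit Arguments.
Unset Strict Implicit.
Unset Printing Implicit Defensive.
Import Order.TTheory GRing.Theory Num.Theory.
Local Open Scope ring_scope.

(** Write [L = U D W] in Smith normal form, [D = diag d], and let [e_i] be the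
    number of nonzero [d_j] of [p]-adic valuation [i], so that [e_0] is the
    [p]-rank and [e_1, e_2, ...] describe [K_p]. Since [p^3 || rs] and
    [(L - r)(L - s) = mu J], no valuation exceeds 3: a column [x] of [W^-1] with
    [L x = 0 mod p^4] would be constant mod [p], like the column spanning
    [ker L]. Hence [e_0 + e_1 + e_2 + e_3 = f + g], and evaluating
    [adj(X - L) 1 = (X - r)^f (X - s)^g 1] at [0] gives
    [e_1 + 2 e_2 + 3 e_3 + gam = f + 2 g]. It remains to locate [e_0 + e_1].
    A saturated integral basis of the [r]-eigenspace stays independent mod [p]
    and shows [f <= e_0 + e_1]; the one of the [s]-eigenspace shows
    [g <= e_2 + e_3 + 1]. If [p] does not divide [v], then [p^3 | mu], and
    [ker L(L - s)] can replace [ker (L - s)], which improves the last bound to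
    [g <= e_2 + e_3]. *)

(** * Ranks of diagonal matrices and Smith normal form *)

Section DiagonalRank.
Variable F : fieldType.

Lemma mxrank_col_support m n (M : 'M[F]_(m, n)) (A : {set 'I_n}) :
  (forall i j, j \notin A -> M i j = 0) -> (\rank M <= #|A|)%N.
Proof.
move=> MA.
have -> : M = \sum_(j in A) col j M *m delta_mx 0 j.
  apply/matrixP=> i k; rewrite summxE.
  under eq_bigr => j _ do rewrite mxE big_ord1 !mxE eqxx /=.
  have [kA|kA] := boolP (k \in A).
    rewrite (bigD1 k) //= eqxx mulr1 big1 ?addr0 // => j /andP[_ jk].
    by rewrite eq_sym (negbTE jk) mulr0.
  rewrite MA // big1 // => j jA.
  by case: (k =P j) kA => [->|]; rewrite ?jA ?mulr0.
rewrite -sum1_card; elim/big_ind2: _ => [|x1 x2 y1 y2 h1 h2|j _].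
- by rewrite mxrank0.
- exact: leq_trans (mxrank_add _ _) (leq_add h1 h2).
- by rewrite (leq_trans (mxrankM_maxr _ _)) ?mxrank_delta.
Qed.

Lemma mxrank_diag n (d : 'rV[F]_n) :
  \rank (diag_mx d) = #|[set j | d 0 j != 0]|.
Proof.
set A := [set j | _]; apply/eqP; rewrite eqn_leq; apply/andP; split.
  apply: mxrank_col_support => i j; rewrite inE negbK !mxE => /eqP dj.
  by case: eqP => [->|//]; rewrite dj.
(* [c] fills the zeros of [d], so the sum of the two diagonal matrices is invertible and their ranks
   add up to at least [n]. *)
pose c : 'rV[F]_n := \row_j (j \notin A)%:R.
have cA : (\rank (diag_mx c) <= #|~: A|)%N.
  apply: mxrank_col_support => i j; rewrite inE negbK !mxE => jA.
  by case: eqP => [->|//]; rewrite jA.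
have : (n <= \rank (diag_mx d) + \rank (diag_mx c))%N.
  apply: leq_trans (mxrank_add _ _); rewrite -raddfD mxrank_unit //.
  rewrite unitmxE det_diag unitfE prodf_seq_neq0; apply/allP => j _ /=.
  rewrite !mxE inE negbK; have [->|dj] := eqVneq (d 0 j) 0.
    by rewrite add0r oner_neq0.
  by rewrite addr0.
by have := cardsC A; rewrite card_ord; lia.
Qed.

End DiagonalRank.

Lemma smith_diag n (M : 'M[int]_n) :
  exists U W (d : 'rV[int]_n),
    [/\ U \in unitmx, W \in unitmx & M = U *m diag_mx d *m W].
Proof.
have [U Uu [W Wu [d _ ->]]] := int_Smith_normal_form M.
exists U, W, (\row_j d`_j); split=> //; congr (_ *m _ *m _).
apply/matrixP=> i j; rewrite !mxE.
by case: (i =P j) => [->|/eqP]; rewrite ?eqxx // -val_eqE => /negbTE->.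
Qed.

(** Unimodular matrices stay invertible under any ring morphism, so the same [d] computes ranks over
    [rat] and over ['F_p]. *)
Lemma mxrank_map_smith (F : fieldType) (phi : {rmorphism int -> F}) n
    (U W : 'M[int]_n) (d : 'rV[int]_n) :
  U \in unitmx -> W \in unitmx ->
  \rank (map_mx phi (U *m diag_mx d *m W)) = #|[set j | phi (d 0 j) != 0]|.
Proof.
have mapu (V : 'M[int]_n) : V \in unitmx -> map_mx phi V \in unitmx.
  by rewrite !unitmxE det_map_mx; apply: rmorph_unit.
move=> /mapu Uu /mapu Wu; rewrite !map_mxM.
rewrite mxrankMfree ?row_free_unit // eqmxMfull ?row_full_unit //.
rewrite map_diag_mx mxrank_diag; apply: eq_card => j.
by rewrite !inE !mxE.
Qed.

(* The witness is a diagonal 0/1 matrix times [U^-1], hence its row lattice is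
   saturated and its rank is the same over [rat] and over [F]. *)
Lemma saturated_left_kernel (F : fieldType) (phi : {rmorphism int -> F}) n
    (M : 'M[int]_n) :
  exists2 X : 'M[int]_n, X *m M = 0
    & \rank (map_mx phi X) = (n - \rank (map_mx (intmul (1 : rat)) M))%N.
Proof.
have [U [W [d [Uu Wu ->]]]] := smith_diag M.
rewrite (mxrank_map_smith _ _ Uu Wu).
pose c : 'rV[int]_n := \row_j (d 0 j == 0)%:R.
(* The factor [1%:M] gives the witness the shape that [mxrank_map_smith] expects. *)
exists (1%:M *m diag_mx c *m invmx U).
  rewrite mul1mx !mulmxA mulmxKV // mulmx_diag.
  set z := \row_j _; suff -> : z = 0 by rewrite raddf0 mul0mx.
  apply/rowP => j; rewrite !mxE; case: eqP => [->|]; first by rewrite mulr0.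
  by rewrite mul0r.
rewrite mxrank_map_smith ?unitmx1 ?unitmx_inv //.
set A := [set j | _ != 0 :> rat].
have <- : (#|~: A| = n - #|A|)%N by have := cardsC A; rewrite card_ord; lia.
apply: eq_card => j.
rewrite !inE negbK !mxE intr_eq0; case: (d 0 j == 0).
  by rewrite rmorph1 oner_eq0.
by rewrite rmorph0 eqxx.
Qed.

(** * Adjugates *)

(* The factors become regular after adding ['X]; then evaluate at [0]. *)
Lemma adj_mulmx (R : idomainType) n (A B : 'M[R]_n) :
  \adj (A *m B) = \adj B *m \adj A.
Proof.
pose X (M : 'M[R]_n) := char_poly_mx (- M).
have X0 (M : 'M[R]_n) : map_mx (horner_eval 0) (X M) = M.
  apply/matrixP => i j; rewrite !mxE /horner_eval hornerD hornerN hornerMn.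
  by rewrite !hornerE mul0rn opprK add0r.
have detX M : \det (X M) != 0 by exact: monic_neq0 (char_poly_monic _).
have /(congr1 (map_mx (horner_eval 0))) :
    \adj (X A *m X B) = \adj (X B) *m \adj (X A).
  apply/eqP; rewrite -subr_eq0; apply/eqP.
  set E := _ - _.
  have : E *m (X A *m X B) *m \adj (X A *m X B) = 0.
    rewrite mulmxBl mul_adj_mx -mulmxA (mulmxA (\adj (X A))) mul_adj_mx.
    rewrite mul_scalar_mx -scalemxAr mul_adj_mx scale_scalar_mx.
    by rewrite det_mulmx subrr mul0mx.
  rewrite -mulmxA mul_mx_adj mul_mx_scalar det_mulmx => /eqP.
  by rewrite scalemx_eq0 !mulf_eq0 !(negbTE (detX _)) => /eqP.
by rewrite map_mxM !map_mx_adj map_mxM !X0.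
Qed.

Lemma adj_diag_mx (R : comNzRingType) n (d : 'rV[R]_n) i :
  (\adj (diag_mx d)) i i = \prod_(j | j != i) d 0 j.
Proof.
rewrite mxE /cofactor addnn -signr_odd odd_double mul1r.
have -> : row' i (col' i (diag_mx d)) = diag_mx (\row_k d 0 (lift i k)).
  by apply/matrixP => a b; rewrite !mxE (inj_eq (@lift_inj _ i)).
rewrite det_diag (eq_bigr (fun k => d 0 (lift i k))) => [|k _]; last by rewrite mxE.
rewrite (reindex_omap (lift i) (unlift i)) => [|j]; last first.
  by case: unliftP => [k -> //|->]; rewrite eqxx.
by apply: eq_bigl => k; rewrite liftK eqxx eq_sym neq_lift.
Qed.

(** * Spectrum and characteristic polynomial *)

(** A split annihilator without repeated roots makes [M] diagonalizable. Comparing characteristic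
    polynomials, the diagonal entries are [t] up to order. *)
Lemma mxrank_horner_spectrum (F : fieldType) n (M : 'M[F]_n.+1) (t : seq F)
    (q : {poly F}) :
  char_poly M = \prod_(x <- t) ('X - x%:P) ->
  horner_mx M (\prod_(x <- undup t) ('X - x%:P)) = 0 ->
  \rank (horner_mx M q) = count (fun x => q.[x] != 0) t.
Proof.
move=> chM M0.
have /mxpoly.diagonalizableP : exists2 rs, uniq rs
    & mxminpoly M %| \prod_(x <- rs) ('X - x%:P).
  by exists (undup t); [exact: undup_uniq | exact: mxminpoly_min].
case=> P Pu /diagonalizable_forPex[d /(simmxLR Pu)].
rewrite mxpoly.conjVmx // => defM.
have /prod_XsubC_eq/permP-> : \prod_(x <- t) ('X - x%:P)
    = \prod_(x <- [seq d 0 j | j <- enum 'I_n.+1]) ('X - x%:P).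
  rewrite -chM big_map big_enum /=.
  have <- : char_poly (diag_mx d) = \prod_(j < n.+1) ('X - (d 0 j)%:P).
    rewrite char_poly_trig ?diag_mx_is_trig //.
    by apply: eq_bigr => j _; rewrite mxE eqxx.
  have detP : \det (map_mx polyC (invmx P)) * \det (map_mx polyC P) = 1.
    by rewrite -det_mulmx -map_mxM mulVmx // map_mx1 det1.
  rewrite defM /char_poly /char_poly_mx -[RHS]mul1r -detP mulrAC -!det_mulmx.
  rewrite mulmxBr mulmxBl !map_mxM; congr (\det (_ - _)).
  by rewrite scalar_mxC -mulmxA -map_mxM mulVmx // map_mx1 mulmx1.
rewrite defM horner_mx_uconjC //.
rewrite mxrankMfree ?row_free_unit // eqmxMfull ?row_full_unit ?unitmx_inv //.
rewrite horner_mx_diag mxrank_diag count_map cardE enumT /enum_mem size_filter.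
apply: eq_count => j.
by rewrite /= inE mxE.
Qed.

(** Since [M x = 0], [(X - M) x = X x]. Applying the adjugate of [X - M] gives [X q x] on one side;
    cancel [X], then evaluate at 0. *)
Lemma adj_eigenvector_kernel n (M : 'M[int]_n) (x : 'cV[int]_n) (q : {poly int}) :
  M *m x = 0 -> char_poly M = 'X * q -> \adj (- M) *m x = q.[0] *: x.
Proof.
move=> Mx chM.
have : \adj (char_poly_mx M) *m map_mx polyC x = q *: map_mx polyC x.
  apply: (scalemx_inj (negbT (polyX_eq0 _))).
  rewrite scalerA -chM /char_poly -[RHS]mul_scalar_mx -mul_adj_mx -mulmxA.
  rewrite scalemxAr.
  congr (_ *m _); rewrite mulmxBl mul_scalar_mx -map_mxM Mx.
  by rewrite map_mx0 subr0.
move/(congr1 (map_mx (horner_eval 0))).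
rewrite map_mxM map_mx_adj map_mxZ.
have -> : map_mx (horner_eval 0) (map_mx polyC x) = x.
  by apply/matrixP => i j; rewrite !mxE /horner_eval hornerC.
suff -> : map_mx (horner_eval 0) (char_poly_mx M) = - M by [].
apply/matrixP => i j; rewrite !mxE /horner_eval.
by rewrite !(hornerD, hornerN, hornerMn, hornerX, hornerC) mul0rn add0r.
Qed.

(** A left eigenvector for [r != 0] is orthogonal to the constant vector, hence killed by
    [const_mx c]. *)
Lemma root_char_poly_quadratic n (M : 'M[int]_n) (a b c r : int) :
  M *m const_mx 1 = 0 :> 'cV_n ->
  M *m M - a *: M + b%:M = const_mx c ->
  r != 0 -> root (char_poly M) r -> r ^+ 2 - a * r + b = 0.
Proof.
move=> M1 quad r0 rootr.
have /det0P[x x0] : \det (r%:M - M) == 0.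
  move: rootr; rewrite /root -[_.[r]]/(horner_eval r _) /char_poly -det_map_mx.
  congr (\det _ == 0); apply/matrixP => i j; rewrite !mxE /= /horner_eval.
  by rewrite !(hornerD, hornerN, hornerMn, hornerX, hornerC).
rewrite mulmxBr mul_mx_scalar => /eqP; rewrite subr_eq0 => /eqP xM.
have x1 : x *m const_mx 1 = 0 :> 'M_1.
  have : r *: (x *m const_mx 1 : 'M[int]_1) = 0.
    by rewrite scalemxAl xM -mulmxA M1 mulmx0.
  by move/eqP; rewrite scalemx_eq0 (negbTE r0) => /eqP.
have : (r ^+ 2 - a * r + b) *: x = 0.
  have <- : x *m const_mx c = 0 :> 'rV[int]_n.
    have -> : const_mx c = (const_mx 1 : 'cV_n) *m const_mx c :> 'M[int]_n.
      by apply/matrixP=> i j; rewrite !mxE big_ord1 !mxE mul1r.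
    by rewrite mulmxA x1 mul0mx.
  rewrite -quad mulmxDr mulmxBr mulmxA -xM -scalemxAl -xM -scalemxAr -xM.
  by rewrite mul_mx_scalar !scalerA -scalerBl -scalerDl expr2.
by move/eqP; rewrite scalemx_eq0 (negbTE x0) orbF => /eqP.
Qed.

(** * The Laplacian of a strongly regular graph *)

Section LaplacianSRG.
Variables (n : nat) (e : rel 'I_n) (v k lam mu : nat).
Hypothesis srgE : srg e v k lam mu.

Lemma tr_laplacian : (laplacian e k)^T = laplacian e k.
Proof.
have [[esym _] _ _ _ _] := srgE.
rewrite /laplacian raddfB /= tr_scalar_mx; congr (_ - _).
by apply/matrixP => i j; rewrite !mxE esym.
Qed.

Lemma laplacian_const : laplacian e k *m const_mx 1 = 0 :> 'cV_n.
Proof.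
have [_ _ kreg _ _] := srgE.
apply/colP => i; rewrite mulmxBl mul_scalar_mx !mxE -(kreg i) mulr1.
rewrite -sum1_card -natz natr_sum big_mkcond /=.
apply/eqP; rewrite subr_eq0; apply/eqP; apply: eq_bigr => j _.
by rewrite !mxE inE mulr1; case: (e i j).
Qed.

Lemma laplacian_quadratic : exists a b : int,
  laplacian e k *m laplacian e k - a *: laplacian e k + b%:M = const_mx mu%:Z.
Proof.
have [[esym eirr] _ kreg lamE muE] := srgE.
(* Substitute [A = k - L] into [A^2 = k + lam A + mu (J - 1 - A)]. *)
exists (2 * k%:Z - lam%:Z + mu%:Z),
  (k%:Z ^+ 2 - k%:Z - lam%:Z * k%:Z + mu%:Z + mu%:Z * k%:Z).
have A2 i j : (adjmx e *m adjmx e) i j = #|[set l | e i l && e j l]|%:Z.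
  rewrite mxE -sum1_card -natz natr_sum [RHS]big_mkcond /=.
  apply: eq_bigr => l _; rewrite !mxE inE (esym l j).
  by case: (e i l); case: (e j l).
rewrite {1 2}/laplacian mulmxBr !mulmxBl !mul_scalar_mx mul_mx_scalar.
apply/matrixP => i j; move: (A2 i j); rewrite !mxE => ->.
have [<-|ij] := eqVneq i j.
  have -> : [set l | e i l && e i l] = [set l | e i l].
    by apply/setP => l; rewrite !inE andbb.
  by rewrite kreg (negbTE (eirr i)) /=; ring.
have [eij|eij] := boolP (e i j).
  by rewrite lamE //= ; ring.
by rewrite muE //=; ring.
Qed.

End LaplacianSRG.

(** * The p-primary torsion of the cokernel *)

Section ExtendByZero.
Variables (T : finType) (A : {set T}) (V : nmodType).

(** The summands of [Gp] are indexed by ordinals, Smith coordinates by columns; [enum_val] links the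
    two. *)
Definition extend0 (x : {ffun 'I_#|A| -> V}) (j : T) : V :=
  oapp x 0 [pick i | enum_val i == j].

Lemma extend0_enum_val x i : extend0 x (enum_val i) = x i.
Proof.
rewrite /extend0; case: pickP => [l /eqP/enum_val_inj -> //|/(_ i)].
by rewrite eqxx.
Qed.

Lemma extend0_out x j : j \notin A -> extend0 x j = 0.
Proof.
rewrite /extend0; case: pickP => [l /eqP<-|//].
by rewrite enum_valP.
Qed.

Lemma extend0_ffun (c : T -> V) j :
  j \in A -> extend0 [ffun i => c (enum_val i)] j = c j.
Proof.
by move=> jA; rewrite -(enum_rankK_in jA jA) extend0_enum_val ffunE.
Qed.

Lemma extend0D x y j : extend0 (x + y) j = extend0 x j + extend0 y j.
Proof.
by rewrite /extend0; case: pickP => [l _|_] /=; rewrite ?ffunE ?addr0.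
Qed.

Lemma extend0_inj x : {in A, extend0 x =1 fun=> 0} -> x = 0.
Proof.
move=> x0; apply/ffunP => i; rewrite -extend0_enum_val x0 ?enum_valP //.
by rewrite ffunE.
Qed.

End ExtendByZero.

(** With the next two lemmas: taking representatives identifies ['Z_m] with the integers mod [m]. As
    ['Z_m] always has at least two elements, [1 < m] is assumed. *)
Lemma Zp_valD_dvdz m (a b : 'Z_m) : (1 < m)%N ->
  (m%:Z %| (nat_of_ord (a + b)%R)%:Z - a%:Z - b%:Z)%Z.
Proof.
move=> m1; have -> : nat_of_ord (a + b)%R = ((a + b) %% m)%N.
  by congr modn; exact: Zp_cast.
rewrite -addrA -opprD -PoszD -eqz_mod_dvd.
by rewrite -!modz_nat modz_mod.
Qed.

Lemma Zp_val_dvdz_eq0 m (a : 'Z_m) : (1 < m)%N -> (m%:Z %| a%:Z)%Z -> a = 0.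
Proof.
move=> m1; rewrite dvdzE !absz_nat => dv; apply/val_inj => /=.
have am : (a < m)%N by rewrite -[X in (_ < X)%N](Zp_cast m1) ltn_ord.
case: (nat_of_ord a) dv am => // b /dvdn_leq-/(_ isT).
by rewrite leqNgt => /negbTE->.
Qed.

Lemma Zp_val_surj m (c : int) : (1 < m)%N -> exists a : 'Z_m, (m%:Z %| c - a%:Z)%Z.
Proof.
move=> m1; pose t := `|(c %% m)%Z|%N.
have tE : t%:Z = (c %% m)%Z by rewrite /t gez0_abs // modz_ge0 //; lia.
have tm : (t < (Zp_trunc m).+2)%N.
  by rewrite Zp_cast // -ltz_nat tE ltz_pmod //; lia.
by exists (Ordinal tm); rewrite -eqz_mod_dvd /= tE modz_mod.
Qed.

(** As [U] is unimodular, [W^-1] carries the row lattice of [L] to that of the diagonal matrix.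
    Where [d 0 j = 0], divisibility means vanishing, and [divzK] still applies. *)
Lemma inImL_smith n (U W : 'M[int]_n) (d x : 'rV[int]_n) :
  U \in unitmx -> W \in unitmx ->
  inImL (U *m diag_mx d *m W) x <-> forall j, (d 0%R j %| (x *m invmx W) 0%R j)%Z.
Proof.
move=> Uu Wu; split=> [[y ->] j|dx].
  by rewrite !mulmxA mulmxK // mul_mx_diag mxE dvdz_mull.
exists ((\row_j ((x *m invmx W) 0%R j %/ d 0%R j)%Z) *m invmx U).
rewrite !mulmxA mulmxKV // mul_mx_diag -[LHS](mulmxKV Wu); congr (_ *m _).
by apply/rowP => j; rewrite [RHS]mxE [in RHS]mxE divzK.
Qed.

Section SmithTorsion.
Variables (n p : nat) (U W : 'M[int]_n) (d : 'rV[int]_n).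
Hypotheses (p_pr : prime p) (Uu : U \in unitmx) (Wu : W \in unitmx).

(** The test [d 0 j != 0] is there because [logn p 0 = 0] would put free coordinates in class 0. *)
Definition smith_class i := [set j | (d 0 j != 0) && (logn p `|d 0 j| == i)].

(* If [d 0 j = 0], then [v j = 0] and [u j = 0]. *)
Let v j := logn p `|d 0 j|.
Let u j : int := (d 0%R j %/ (p ^ v j)%:Z)%Z.

Hypothesis v_le3 : forall j, d 0 j != 0 -> (v j <= 3)%N.

Local Notation A := smith_class.
Local Notation G := (Gp p #|A 1| #|A 2| #|A 3|).

(** The classes are disjoint, so at most one term is nonzero: [N a j] represents the coordinate of
    [a] at column [j]. *)
Let N (a : G) j : int :=
  (extend0 a.1.1 j)%:Z + (extend0 a.1.2 j)%:Z + (extend0 a.2 j)%:Z.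

Let pX_gt1 i : (0 < i)%N -> (1 < p ^ i)%N.
Proof. by move=> i0; rewrite -(exp1n i) ltn_exp2r // prime_gt1. Qed.

Let dE j : d 0 j = u j * (p ^ v j)%:Z.
Proof. by rewrite divzK // dvdzE /= pfactor_dvdnn. Qed.

Let u_neq0 j : d 0 j != 0 -> u j != 0.
Proof. by rewrite {1}dE mulf_eq0 negb_or => /andP[]. Qed.

Let u0 j : d 0 j = 0 -> u j = 0.
Proof. by rewrite /u => ->; rewrite div0z. Qed.

Let coprime_u j m : d 0 j != 0 -> coprimez (u j) (p ^ m)%:Z.
Proof.
move=> dj; rewrite coprimezE /= coprime_sym coprimeXl // prime_coprime //.
apply/negP => pu; have d0 : (0 < `|d 0%R j|)%N by rewrite absz_gt0.
have : (p ^ (v j).+1 %| `|d 0%R j|)%N.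
  by rewrite dE abszM absz_nat expnS dvdn_mul.
by rewrite pfactor_dvdn // ltnn.
Qed.

Let ext_out i k j (x : {ffun 'I_#|A k| -> 'Z_(p ^ k)}) :
  j \in A i -> i != k -> (extend0 x j)%:Z = 0.
Proof.
rewrite inE => /andP[dj /eqP vj] ik; rewrite extend0_out //.
by rewrite inE dj vj.
Qed.

(** [ND], [N_inj] and [N_surj] together identify [G] with the product of the [Z/p^(v j)] over the
    columns with [d 0 j != 0]. *)
Let ND a b j : ((p ^ v j)%:Z %| N (a + b) j - N a j - N b j)%Z.
Proof.
have ext i (x y : {ffun 'I_#|A i| -> 'Z_(p ^ i)}) : (0 < i)%N ->
    ((p ^ v j)%:Z %| (extend0 (x + y) j)%:Z - (extend0 x j)%:Z - (extend0 y j)%:Z)%Z.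
  move=> i0; have [|jA] := boolP (j \in A i); last by rewrite !extend0_out.
  rewrite inE extend0D => /andP[_ /eqP vj]; have -> : v j = i by [].
  exact: Zp_valD_dvdz (pX_gt1 _).
have -> : N (a + b) j - N a j - N b j =
  ((extend0 (a.1.1 + b.1.1) j)%:Z - (extend0 a.1.1 j)%:Z - (extend0 b.1.1 j)%:Z)
  + ((extend0 (a.1.2 + b.1.2) j)%:Z - (extend0 a.1.2 j)%:Z - (extend0 b.1.2 j)%:Z)
  + ((extend0 (a.2 + b.2) j)%:Z - (extend0 a.2 j)%:Z - (extend0 b.2 j)%:Z).
  by rewrite /N /=; ring.
by apply: rpredD; [apply: rpredD|]; apply: ext.
Qed.

Let N_inj a :
  (forall j, d 0 j != 0 -> ((p ^ v j)%:Z %| N a j)%Z) -> a = 0.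
Proof.
move=> Na.
have ext0 i (x : {ffun 'I_#|A i| -> 'Z_(p ^ i)}) : (0 < i)%N ->
    (forall j, j \in A i -> N a j = (extend0 x j)%:Z) -> x = 0.
  move=> i0 Nx; apply: extend0_inj => j jA.
  apply: Zp_val_dvdz_eq0; rewrite ?pX_gt1 // -Nx //.
  by move: jA; rewrite inE => /andP[dj /eqP<-]; exact: Na.
case: a => -[a1 a2] a3 in Na ext0 *.
congr (_, _, _); apply: ext0 => // j jA; rewrite /N /=.
- by rewrite (ext_out a2 jA) // (ext_out a3 jA) // !addr0.
- by rewrite (ext_out a1 jA) // (ext_out a3 jA) // add0r addr0.
- by rewrite (ext_out a1 jA) // (ext_out a2 jA) // !add0r.
Qed.

Let N_surj (c : 'I_n -> int) :
  exists a, forall j, d 0 j != 0 -> ((p ^ v j)%:Z %| c j - N a j)%Z.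
Proof.
have ext i : (0 < i)%N -> exists x : {ffun 'I_#|A i| -> 'Z_(p ^ i)},
    forall j, j \in A i -> ((p ^ v j)%:Z %| c j - (extend0 x j)%:Z)%Z.
  move=> i0; have /fin_all_exists[y yP] j := Zp_val_surj (c j) (pX_gt1 i0).
  exists [ffun l => y (enum_val l)] => j jA; rewrite extend0_ffun //.
  have -> : v j = i by move: jA; rewrite inE => /andP[_ /eqP].
  exact: yP.
have [x1 x1P] := ext 1 isT; have [x2 x2P] := ext 2 isT.
have [x3 x3P] := ext 3 isT; exists (x1, x2, x3) => j dj.
have jA : j \in A (v j) by rewrite inE dj eqxx.
move: (v_le3 dj) jA; rewrite /N /=; case vj: (v j) => [|[|[|[|//]]]] _ jA.
- by rewrite expn0 dvd1z.
- by rewrite (ext_out x2 jA) // (ext_out x3 jA) // !addr0; have := x1P _ jA; rewrite vj.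
- by rewrite (ext_out x1 jA) // (ext_out x3 jA) // add0r addr0; have := x2P _ jA; rewrite vj.
- by rewrite (ext_out x1 jA) // (ext_out x2 jA) // !add0r; have := x3P _ jA; rewrite vj.
Qed.

(** In Smith coordinates the cokernel is the sum of the [Z/d_j]. As [d_j = u_j p^(v_j)] with [u_j]
    prime to [p] when [d_j != 0], the p-primary part of [Z/d_j] is generated by [u_j], whence the
    factor [u j] in [t]. *)
Lemma coker_ptorsion_smith :
  coker_sub_iso (U *m diag_mx d *m W) (ptorsK p (U *m diag_mx d *m W)) G.
Proof.
pose t a : 'rV[int]_n := \row_j (u j * N a j).
exists (fun a => t a *m W); split=> [a b|a|x].
- apply/(inImL_smith _ _ Uu Wu) => j.
  rewrite -!mulmxBl mulmxK // !mxE -!mulrBr dE dvdz_mul //; exact: ND.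
- move/(inImL_smith _ _ Uu Wu) => ta; apply: N_inj => j dj.
  have := ta j; rewrite mulmxK // mxE {1}dE dvdz_mul2l ?u_neq0 //.
split=> [[m /(inImL_smith _ _ Uu Wu) xm]|[a /(inImL_smith _ _ Uu Wu) xa]].
  pose xi := x *m invmx W.
  have {}xm j : (d 0%R j %| xi 0%R j * (p ^ m)%:Z)%Z.
    have := xm j; rewrite -scaler_nat -scalemxAl mxE mulrC.
    by rewrite natz.
  have xi0 j : d 0 j = 0 -> xi 0 j = 0.
    move=> dj; have := xm j; rewrite dj dvd0z mulf_eq0.
    by rewrite [(p ^ m)%:Z == 0]eqz_nat expn_eq0 (gtn_eqF (prime_gt0 p_pr)) orbF => /eqP.
  have uxi j : d 0 j != 0 -> (u j %| xi 0%R j)%Z.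
    move=> dj; rewrite -(Gauss_dvdzl _ (coprime_u m dj)).
    by apply: dvdz_trans (xm j); rewrite dE dvdz_mulr.
  have [a aP] := N_surj (fun j => (xi 0%R j %/ u j)%Z).
  exists a; apply/(inImL_smith _ _ Uu Wu) => j.
  rewrite mulmxBl mulmxK // -/xi.
  have -> : (xi - t a) 0 j = xi 0 j - u j * N a j by rewrite !mxE.
  have [dj|dj] := eqVneq (d 0 j) 0; first by rewrite u0 // xi0 // mul0r subrr.
  by rewrite -{1}(divzK (uxi j dj)) [X in X - _]mulrC -mulrBr dE dvdz_mul ?aP.
(* All valuations are at most 3, so [p ^ 3] kills the p-primary part. *)
exists 3; apply/(inImL_smith _ _ Uu Wu) => j.
pose y := x *m invmx W; have := xa j; rewrite mulmxBl mulmxK // -/y.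
have -> : (y - t a) 0 j = y 0 j - u j * N a j by rewrite !mxE.
rewrite -scaler_nat -scalemxAl -/y => dy.
have -> : ((p ^ 3)%:R *: y) 0 j
    = (p ^ 3)%:R * (y 0 j - u j * N a j) + (u j * (p ^ 3)%:Z) * N a j.
  by rewrite [LHS]mxE natz; ring.
apply: rpredD; [exact: dvdz_mull | apply: dvdz_mulr].
have [dj|dj] := eqVneq (d 0 j) 0; first by rewrite dj u0 // mul0r.
by rewrite {1}dE dvdz_mul // dvdzE /= dvdn_exp2l // v_le3.
Qed.

End SmithTorsion.

(** * Exact powers of a prime *)

Lemma logn_prod_pos (I : finType) (P : pred I) (F : I -> nat) p :
  (forall i, P i -> (0 < F i)%N) ->
  logn p (\prod_(i | P i) F i) = (\sum_(i | P i) logn p (F i))%N.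
Proof.
move=> F0; suff [//] : logn p (\prod_(i | P i) F i)
    = (\sum_(i | P i) logn p (F i))%N /\ (0 < \prod_(i | P i) F i)%N.
elim/big_rec2: _ => [|i x y Pi [<- y0]]; first by rewrite logn1.
by rewrite lognM ?F0 // muln_gt0 F0.
Qed.

Lemma pexact_logn p a m : prime p -> pexact p a m -> (0 < m)%N /\ logn p m = a.
Proof.
move=> p_pr /andP[]; have [->|m0] := posnP m; first by rewrite !dvdn0.
by rewrite !pfactor_dvdn // => ? ?; split=> //; lia.
Qed.

Lemma logn_pexact p m : prime p -> (0 < m)%N -> pexact p (logn p m) m.
Proof. by move=> p_pr m0; rewrite /pexact !pfactor_dvdn // leqnn ltnn. Qed.

Lemma pexact_dvdz_mul p a b (x y : int) : prime p -> pexact p a `|x|%N ->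
  ((p ^ (a + b))%:Z %| x * y)%Z -> ((p ^ b)%:Z %| y)%Z.
Proof.
move=> p_pr /andP[/dvdnP[z xE] xNp]; rewrite !dvdzE abszM !absz_nat xE.
rewrite expnD (mulnC z) -mulnA dvdn_pmul2l ?expn_gt0 ?prime_gt0 //.
rewrite Gauss_dvdr //.
rewrite coprimeXl // prime_coprime //; apply: contra xNp => pz.
by rewrite xE expnS dvdn_mul.
Qed.

Lemma intr_Fp_eq0 p (z : int) : prime p -> (z%:~R == 0 :> 'F_p) = (p %| `|z|)%N.
Proof.
move=> p_pr; rewrite (dvdn_pcharf (pchar_Fp p_pr)).
by case: (intP z) => [//|m|m]; rewrite ?mulrNz ?oppr_eq0 ?abszN -?pmulrn.
Qed.

(** * Rational ranks of polynomials in the Laplacian *)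

(** The cubic has the distinct eigenvalues 0, [r], [s] as simple roots, so [mxrank_horner_spectrum]
    applies over [rat]. It supplies every kernel dimension used below. *)
Lemma mxrank_horner_0rs n (L : 'M[int]_n.+1) (r s : int) f g (q : {poly int}) :
  r != 0 -> s != 0 -> r != s -> (0 < f)%N -> (0 < g)%N ->
  char_poly L = 'X * ('X - r%:P) ^+ f * ('X - s%:P) ^+ g ->
  L *m (L *m L - (r + s) *: L + (r * s)%:M) = 0 ->
  \rank (map_mx (intmul (1 : rat)) (horner_mx L q))
    = ((q.[0] != 0) + f * (q.[r] != 0) + g * (q.[s] != 0))%N.
Proof.
move=> r0 s0 rs f0 g0 chL L0.
have inj : injective (intmul (1 : rat)) by exact: intr_inj.
have hXC (x : int) : map_poly (intmul (1 : rat)) ('X - x%:P) = 'X - (x%:~R)%:P.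
  by rewrite rmorphB /= map_polyX map_polyC.
pose t := 0 :: nseq f r ++ nseq g s.
rewrite map_horner_mx (@mxrank_horner_spectrum _ _ _ (map intr t)).
- rewrite count_map (eq_count (a2 := fun x => q.[x] != 0)).
    by rewrite /= count_cat !count_nseq addnA mulnC [(_ * g)%N]mulnC.
  by move=> x; rewrite /= horner_map /= intr_eq0.
- rewrite -map_char_poly chL big_map /= big_cons big_cat /=.
  rewrite !rmorphM !rmorphXn /= !hXC map_polyX subr0 !big_nseq.
  by rewrite !iter_mulr_1 mulrA.
have -> : \prod_(x <- undup [seq y%:~R | y <- t]) ('X - x%:P)
    = map_poly (intmul (1 : rat)) ('X * ('X^2 - (r + s) *: 'X + (r * s)%:P)).
  rewrite undup_map_inj // big_map.
  have tE : perm_eq (undup t) [:: 0; r; s].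
    apply: uniq_perm => [||x]; first exact: undup_uniq.
      by rewrite /= !inE negb_or !(eq_sym 0) r0 s0 rs.
    by rewrite mem_undup !inE mem_cat !mem_nseq f0 g0.
  rewrite (perm_big _ tE) !big_cons big_nil /= mulr1.
  rewrite -!hXC -!rmorphM /=; congr map_poly.
  by rewrite -mul_polyC polyCD polyCM; ring.
rewrite -map_horner_mx rmorphM /= horner_mx_X rmorphD rmorphB /= horner_mxZ.
by rewrite rmorphXn /= horner_mx_X horner_mx_C expr2 -!mulmxE L0 map_mx0.
Qed.

(** * The kernel of the Laplacian and the product of its invariants *)

Section SmithKernel.
Variables (n : nat) (U W : 'M[int]_n) (d : 'rV[int]_n) (j0 : 'I_n).
Hypotheses (Uu : U \in unitmx) (Wu : W \in unitmx).
Hypotheses (d_j0 : d 0 j0 = 0) (d_neq0 : forall j, j != j0 -> d 0 j != 0).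

Lemma smith_mul_const_eq0 j :
  U *m diag_mx d *m W *m const_mx 1 = 0 :> 'cV_n ->
  j != j0 -> (W *m const_mx 1 : 'cV_n) j 0 = 0.
Proof.
move=> L1 jj0.
have /colP/(_ j) : diag_mx d *m (W *m const_mx 1) = 0 :> 'cV_n.
  by rewrite -[LHS](mulKmx Uu) (mulmxA U) (mulmxA _ W) L1 mulmx0.
rewrite mul_diag_mx mxE [RHS]mxE => /eqP.
by rewrite mulf_eq0 (negbTE (d_neq0 jj0)) => /eqP.
Qed.

(** [W 1] is [b] times the unit vector at [j0], so the constant vector 1 is [b] times column [j0] of
    [W^-1]; over the integers this forces [b] to be 1 or -1. *)
Lemma smith_invmx_col :
  U *m diag_mx d *m W *m const_mx 1 = 0 :> 'cV_n ->
  exists2 c, `|c|%N = 1%N & forall i, invmx W i j0 = c.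
Proof.
move=> L1; pose b := (W *m const_mx 1 : 'cV_n) j0 0.
have b1 i : invmx W i j0 * b = 1.
  have /colP/(_ i) : const_mx 1 = invmx W *m (W *m const_mx 1) :> 'cV_n.
    by rewrite mulKmx.
  rewrite mxE [RHS]mxE (bigD1 j0) //= big1 ?addr0 => [-> //|j jj0].
  by rewrite smith_mul_const_eq0 // mulr0.
have bw i : `|invmx W i j0|%N = 1%N /\ invmx W i j0 = b.
  have := b1 i; move: (invmx W i j0) => w wb.
  have /eqP := congr1 absz wb; rewrite abszM muln_eq1 => /andP[/eqP w1 _].
  split=> //; have [] : w = 1 \/ w = - 1.
    by case: w w1 {wb} => [[|[|m]]|[|m]] // _; [left|right].
  - by move=> w_eq; move: wb; rewrite w_eq mul1r.
  - by move=> w_eq; move: wb; rewrite w_eq mulN1r => <-; rewrite opprK.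
by exists b => [|i]; have [] := bw j0; [move=> <- <- | case: (bw i)].
Qed.

(** The products of [diag_mx d] with its adjugate vanish on both sides, which leaves only the entry
    at [j0], [j0]. *)
Lemma adj_diag_smith :
  \adj (diag_mx d) = (\prod_(j | j != j0) d 0 j) *: delta_mx j0 j0.
Proof.
have detD : \det (diag_mx d) = 0.
  by rewrite det_diag (bigD1 j0) //= d_j0 mul0r.
have row0 a b : a != j0 -> \adj (diag_mx d) a b = 0.
  move=> aj0; have /matrixP/(_ a b) : diag_mx d *m \adj (diag_mx d) = 0.
    by rewrite mul_mx_adj detD raddf0.
  rewrite mul_diag_mx [LHS]mxE [RHS]mxE => /eqP.
  by rewrite mulf_eq0 (negbTE (d_neq0 aj0)) => /eqP.
have col0 a b : b != j0 -> \adj (diag_mx d) a b = 0.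
  move=> bj0; have /matrixP/(_ a b) : \adj (diag_mx d) *m diag_mx d = 0.
    by rewrite mul_adj_mx detD raddf0.
  rewrite mul_mx_diag [LHS]mxE [RHS]mxE => /eqP.
  by rewrite mulf_eq0 (negbTE (d_neq0 bj0)) orbF => /eqP.
apply/matrixP => a b; rewrite [RHS]mxE [X in _ * X]mxE.
have [->|/row0->] := eqVneq a j0; last by rewrite mulr0.
have [->|/col0->] := eqVneq b j0; last by rewrite mulr0.
by rewrite mulr1 adj_diag_mx.
Qed.

End SmithKernel.

Lemma absz_det_unit n (V : 'M[int]_n) : V \in unitmx -> `|\det V|%N = 1%N.
Proof.
move=> Vu; have /eqP : `|(\det V * \det (invmx V))%R|%N = 1%N.
  by rewrite -det_mulmx mulmxV // det1.
by rewrite abszM muln_eq1 => /andP[/eqP].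
Qed.

(** A form of the matrix-tree theorem: [adj(L) 1] is computed once from the Smith form and once, up
    to sign, from the characteristic polynomial. *)
Lemma prod_smith_invariants n (U W : 'M[int]_n) (d : 'rV[int]_n) (j0 : 'I_n)
    (q : {poly int}) (L := U *m diag_mx d *m W) :
  U \in unitmx -> W \in unitmx ->
  d 0 j0 = 0 -> (forall j, j != j0 -> d 0 j != 0) ->
  L *m const_mx 1 = 0 :> 'cV_n -> L^T = L -> char_poly L = 'X * q ->
  (`|(\prod_(j | j != j0) d 0 j)%R| * n)%N = `|q.[0]|%N.
Proof.
move=> Uu Wu d0 dN0 L1 LT chL.
have [c c1 cP] := smith_invmx_col Uu Wu dN0 L1.
(* By symmetry [L = W^T D U^T] is also a Smith form, so row [j0] of [U^-1] is constant too. *)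
have [c' c'1 c'P] : exists2 c, `|c|%N = 1%N & forall i, invmx U j0 i = c.
  have L1' : W^T *m diag_mx d *m U^T *m const_mx 1 = 0 :> 'cV_n.
    by rewrite -[RHS]L1 -LT /L !trmx_mul tr_diag_mx mulmxA.
  have [|| c' c'1 c'P] := smith_invmx_col _ _ dN0 L1'; rewrite ?unitmx_tr //.
  by exists c' => // i; rewrite -(c'P i) -trmx_inv mxE.
have adjU (V : 'M[int]_n) : V \in unitmx -> \adj V = \det V *: invmx V.
  by move=> Vu; rewrite -[RHS]mul_scalar_mx -mul_adj_mx mulmxK.
set P := \prod_(j | _) _.
have adjL : \adj L *m const_mx 1
    = (\det W * \det U * P * (c * c' * n%:R)) *: const_mx 1 :> 'cV_n.
  rewrite /L !adj_mulmx (adj_diag_smith d0 dN0) !adjU // -/P.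
  rewrite -!(scalemxAl, scalemxAr) !scalerA.
  have -> : invmx W *m (delta_mx j0 j0 *m invmx U) *m const_mx 1
      = (c * c' * n%:R) *: const_mx 1 :> 'cV_n.
    apply/colP => i; rewrite -!mulmxA mxE (bigD1 j0) //= big1 ?addr0 => [|j jj0].
      rewrite cP !mxE mulr1 (bigD1 j0) //= big1 ?addr0 => [|j jj0].
        rewrite !mxE !eqxx mul1r -mulrA; congr (_ * _).
        under eq_bigr => l _ do rewrite mxE mulr1 c'P.
        by rewrite sumr_const card_ord mulr_natr.
      by rewrite mxE (negbTE jj0) andbF mul0r.
    by rewrite mxE big1 ?mulr0 // => l _; rewrite mxE (negbTE jj0) mul0r.
  by rewrite !scalerA; congr (_ *: _); ring.
have := adj_eigenvector_kernel L1 chL.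
rewrite -scaleN1r adjZ -scalemxAl adjL scalerA => /colP/(_ j0).
rewrite !mxE !mulr1 => <-.
rewrite !abszM !abszX c1 c'1 abszN1 exp1n.
by rewrite !absz_det_unit // natz absz_nat !mul1n.
Qed.

(** * Divisibility and Smith classes modulo p *)

Lemma dvdz_mulmx_r m n k (a : int) (X : 'M[int]_(m, n)) (Y : 'M[int]_(n, k)) :
  (forall i j, (a %| X i j)%Z) -> forall i j, (a %| (X *m Y) i j)%Z.
Proof. by move=> aX i j; rewrite mxE rpred_sum // => l _; apply: dvdz_mulr. Qed.

Lemma dvdz_mulmx_l m n k (a : int) (X : 'M[int]_(m, n)) (Y : 'M[int]_(n, k)) :
  (forall i j, (a %| Y i j)%Z) -> forall i j, (a %| (X *m Y) i j)%Z.
Proof. by move=> aY i j; rewrite mxE rpred_sum // => l _; apply: dvdz_mull. Qed.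

Section SmithModP.
Variables (n p : nat) (U W : 'M[int]_n) (d : 'rV[int]_n).
Hypotheses (p_pr : prime p) (Uu : U \in unitmx) (Wu : W \in unitmx).

Local Notation L := (U *m diag_mx d *m W).
Local Notation mapp := (map_mx (intmul (1 : 'F_p))).

(** Its size is [e_0 + e_1]. The complement also contains the free columns, where [d 0 j = 0]. *)
Definition smith_le1 := smith_class p d 0 :|: smith_class p d 1.

Lemma mem_smith_le1 j :
  (j \in smith_le1) = (d 0 j != 0) && (logn p `|d 0%R j| <= 1)%N.
Proof. by rewrite !inE -andb_orr; case: (logn _ _) => [|[|]]. Qed.

Lemma card_smith_le1 :
  #|smith_le1| = (#|smith_class p d 0| + #|smith_class p d 1|)%N.
Proof.
rewrite cardsU; suff -> : smith_class p d 0 :&: smith_class p d 1 = set0.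
  by rewrite cards0 subn0.
by apply/setP => j; rewrite !inE; case: (d 0 j == 0) => //=; case: (logn p _) => [|[|]].
Qed.

Lemma prank_smith : prank p L = #|smith_class p d 0|.
Proof.
rewrite /prank (mxrank_map_smith (intmul (1 : 'F_p)) _ Uu Wu).
apply: eq_card => j; rewrite !inE intr_Fp_eq0 //.
have [->|dj] := eqVneq (d 0 j) 0; first by rewrite dvdn0.
by rewrite -[p in (p %| _)%N]expn1 pfactor_dvdn ?absz_gt0 // -eqn0Ngt.
Qed.

Lemma mxrank_mapp_unit (X V : 'M[int]_n) :
  V \in unitmx -> \rank (mapp (X *m V)) = \rank (mapp X).
Proof.
move=> Vu; rewrite map_mxM mxrankMfree // row_free_unit unitmxE det_map_mx.
by rewrite rmorph_unit // -unitmxE.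
Qed.

(** [X U D = r X W^-1]; outside [smith_le1], [p^2] divides [d_j] while [p || r], so that column of
    [X W^-1] vanishes mod [p]. *)
Lemma mxrank_eigen_le (r : int) (X : 'M[int]_n) :
  pexact p 1 `|r| -> X *m L = r *: X -> (\rank (mapp X) <= #|smith_le1|)%N.
Proof.
move=> pr XL; rewrite -(mxrank_mapp_unit X (V := invmx W)) ?unitmx_inv //.
apply: mxrank_col_support => i j; rewrite mem_smith_le1 => jN.
apply/eqP; rewrite mxE intr_Fp_eq0 //.
have E : X *m U *m diag_mx d = r *: (X *m invmx W).
  by rewrite scalemxAl -XL !mulmxA mulmxK.
suff : ((p ^ 1)%:Z %| (X *m invmx W) i j)%Z by rewrite dvdzE absz_nat expn1.
apply: (pexact_dvdz_mul p_pr pr).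
have /matrixP/(_ i j) := E; rewrite mul_mx_diag [LHS]mxE [RHS]mxE => <-.
apply: dvdz_mull; rewrite dvdzE absz_nat.
move: jN; have [->|dj] := eqVneq (d 0 j) 0; first by rewrite dvdn0.
by rewrite /= -ltnNge pfactor_dvdn // absz_gt0.
Qed.

(** [X U D = X L W^-1] is divisible by [p^2], so the columns of [X U] in [smith_le1] vanish mod
    [p]. *)
Lemma mxrank_dvd_le (X : 'M[int]_n) :
  (forall i j, ((p ^ 2)%:Z %| (X *m L) i j)%Z) ->
  (\rank (mapp X) <= #|~: smith_le1|)%N.
Proof.
move=> XL; rewrite -(mxrank_mapp_unit X Uu).
apply: mxrank_col_support => i j; rewrite inE negbK mem_smith_le1 => /andP[dj vj].
apply/eqP; rewrite mxE intr_Fp_eq0 //.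
have E : X *m U *m diag_mx d = X *m L *m invmx W by rewrite !mulmxA mulmxK.
have := dvdz_mulmx_r (invmx W) XL i j.
rewrite -E mul_mx_diag [X in (_ %| X)%Z]mxE mulrC.
move=> p2; have d0 : (0 < `|d 0%R j|)%N by rewrite absz_gt0.
suff : ((p ^ 1)%:Z %| (X *m U) i j)%Z by rewrite dvdzE absz_nat expn1.
apply: (pexact_dvdz_mul p_pr (logn_pexact p_pr d0)).
by apply: dvdz_trans p2; rewrite dvdzE !absz_nat dvdn_exp2l // addn1.
Qed.

Lemma smith_logn_le3 (c rs t : int) j0 :
  d 0 j0 = 0 -> (forall j, j != j0 -> d 0 j != 0) ->
  L *m const_mx 1 = 0 :> 'cV_n ->
  L *m L - t *: L + rs%:M = const_mx c -> pexact p 3 `|rs| ->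
  forall j, d 0 j != 0 -> (logn p `|d 0%R j| <= 3)%N.
Proof.
move=> dj0 dN0 L1 quad p3 j dj; rewrite leqNgt; apply/negP => v4.
have jj0 : j != j0 by apply: contraNneq dj => ->; rewrite dj0.
pose x : 'cV_n := col j (invmx W).
have Lx : forall i l, ((p ^ 4)%:Z %| (L *m x) i l)%Z.
  have -> : L *m x = U *m (diag_mx d *m delta_mx j 0).
    by rewrite /x colE [LHS]mulmxA mulmxK // mulmxA.
  apply: dvdz_mulmx_l => i l; rewrite mul_diag_mx mxE mxE.
  case: (i =P j) => [->|_]; last by rewrite mulr0.
  by rewrite dvdz_mulr // dvdzE absz_nat pfactor_dvdn // absz_gt0.
(* Multiply [L x], divisible by [p^4], by [L - t] and use the quadratic relation; differences of
   entries then eliminate [c]. *)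
have p4 i : ((p ^ 4)%:Z %| (c * (\sum_l x l 0) - rs * x i 0)%R)%Z.
  have -> : c * (\sum_l x l 0) - rs * x i 0 = ((L - t%:M) *m (L *m x)) i 0.
    have -> : (L - t%:M) *m (L *m x) = const_mx c *m x - rs *: x.
      rewrite [LHS]mulmxBl -quad mulmxDl mulmxBl !mul_scalar_mx addrK.
      by rewrite -scalemxAl (mulmxA L L x).
    rewrite !mxE mulr_sumr; congr (_ - _).
    by apply: eq_bigr => l _; rewrite !mxE.
  exact: dvdz_mulmx_l.
have px i l : (p %| x i 0%R - x l 0%R)%Z.
  rewrite -[p]expn1; apply: (pexact_dvdz_mul p_pr p3).
  have -> : rs * (x i 0 - x l 0) = (c * (\sum_m x m 0) - rs * x l 0)
      - (c * (\sum_m x m 0) - rs * x i 0) by ring.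
  exact: rpredB.
have Wx : (W *m x) j 0 = 1 by rewrite /x colE mulKVmx // mxE !eqxx.
have W0 : \sum_l W j l = 0.
  rewrite -[RHS](smith_mul_const_eq0 Uu dN0 L1 jj0) mxE.
  by apply: eq_bigr => l _; rewrite mxE mulr1.
have /negP[] : ~~ (p%:Z %| 1%R)%Z.
  by rewrite dvdzE absz_nat dvdn1; case: p p_pr => [|[]].
(* Row [j] of [W] sums to 0, so [x j 0] may be subtracted from every entry; this makes 1 divisible
   by [p]. *)
rewrite -Wx; have -> : (W *m x) j 0 = \sum_l W j l * (x l 0 - x j 0).
  rewrite mxE; under [RHS]eq_bigr do rewrite mulrBr.
  by rewrite sumrB -mulr_suml W0 mul0r subr0.
by apply: rpred_sum => l _; apply: dvdz_mull; exact: px.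
Qed.

End SmithModP.

(** * Counting the Smith classes *)

Section SmithCounting.
Variables (n p : nat) (d : 'rV[int]_n) (j0 : 'I_n).
Hypotheses (d_j0 : d 0 j0 = 0) (d_neq0 : forall j, j != j0 -> d 0 j != 0).
Hypothesis v_le3 : forall j, d 0 j != 0 -> (logn p `|d 0%R j| <= 3)%N.

Local Notation v j := (logn p `|d 0%R j|).
Local Notation A := (smith_class p d).

Lemma card_smith_class i : #|A i| = (\sum_(j | j != j0) (v j == i))%N.
Proof.
rewrite -sum1_card big_mkcond [RHS]big_mkcond /=; apply: eq_bigr => j _.
rewrite inE; have [->|jj0] := eqVneq j j0; first by rewrite d_j0 eqxx.
by rewrite d_neq0 //=; case: (_ == i).
Qed.

(** The successor accounts for [j0], which lies in no class. *)
Lemma sum_card_smith_class :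
  (#|A 0| + #|A 1| + #|A 2| + #|A 3|).+1 = n.
Proof.
rewrite !card_smith_class -!big_split /= -[RHS]card_ord -[in RHS]sum1_card.
rewrite [RHS](bigD1 j0) //= add1n; congr _.+1; apply: eq_bigr => j jj0.
by have := v_le3 (d_neq0 jj0); case: (logn _ _) => [|[|[|[|]]]].
Qed.

Lemma logn_prod_smith :
  logn p `|(\prod_(j | j != j0) d 0 j)%R|%N = (#|A 1| + 2 * #|A 2| + 3 * #|A 3|)%N.
Proof.
have -> : `|(\prod_(j | j != j0) d 0 j)%R|%N = (\prod_(j | j != j0) `|d 0%R j|)%N.
  by apply: (big_morph absz) => [x y|//]; rewrite abszM.
rewrite logn_prod_pos => [|j jj0]; last by rewrite absz_gt0 d_neq0.
rewrite !card_smith_class !big_distrr -!big_split /=; apply: eq_bigr => j jj0.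
by have := v_le3 (d_neq0 jj0); case: (logn _ _) => [|[|[|[|]]]].
Qed.

End SmithCounting.

(** * The two possible Sylow subgroups *)

Lemma size_char_poly_0rs n (L : 'M[int]_n) (r s : int) f g :
  char_poly L = 'X * ('X - r%:P) ^+ f * ('X - s%:P) ^+ g -> n = (f + g).+1.
Proof.
move=> /(congr1 (fun q : {poly int} => size q)).
rewrite size_char_poly !size_mul ?mulf_neq0 ?expf_neq0 ?polyX_eq0 ?polyXsubC_eq0 //.
by rewrite size_polyX !size_exp_XsubC; lia.
Qed.

(** [r] and [s] are not ordered, so the version with roles interchanged is the instance with
    [(r, f)] and [(s, g)] swapped. *)
Theorem theorem3p8 (n : nat) (e : rel 'I_n) (v k lam mu : nat)
    (r s : int) (f g p e0 gam : nat) :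
  srg e v k lam mu ->
  connected_graph e ->
  r != 0 -> s != 0 -> r != s -> (0 < f)%N -> (0 < g)%N ->
  char_poly (laplacian e k) = 'X * ('X - r%:P) ^+ f * ('X - s%:P) ^+ g ->
  prime p ->
  (exists G : finZmodType,
      coker_sub_iso (laplacian e k) (torsK (laplacian e k)) G /\ (p %| #|G|)%N) ->
  e0 = prank p (laplacian e k) ->
  pexact p 1 `|r|%N -> pexact p 2 `|s|%N ->
  pexact p gam v ->
  (Kp_iso p (laplacian e k) (f%:Z - e0%:Z) (g%:Z + gam%:Z - e0%:Z)
          (e0%:Z - gam%:Z)
   \/ Kp_iso p (laplacian e k) (f%:Z + 1 - e0%:Z) (g%:Z + gam%:Z - 2 - e0%:Z)
          (e0%:Z - gam%:Z + 1))
  /\ (gam = 0%N ->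
      Kp_iso p (laplacian e k) (f%:Z - e0%:Z) (g%:Z - e0%:Z) (e0%:Z)).
Proof.
move=> srgE _ r0 s0 rs f0 g0 chL p_pr _ e0E pr ps pgam.
have nfg := size_char_poly_0rs chL.
have nv : n = v by case: srgE.
case: n => [//|n] in e srgE chL e0E nfg nv *.
have LT := tr_laplacian srgE; have L1 := laplacian_const srgE.
have [a [b quad]] := laplacian_quadratic srgE.
have rootP x : (x == r) || (x == s) -> root (char_poly (laplacian e k)) x.
  rewrite chL /root !(hornerM, horner_exp, hornerXsubC).
  move=> /orP[]/eqP->; rewrite subrr expr0n.
    by rewrite (gtn_eqF f0) mulr0 mul0r.
  by rewrite (gtn_eqF g0) mulr0.
have := root_char_poly_quadratic L1 quad r0 (rootP r _).
rewrite eqxx => /(_ isT) qr.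
have := root_char_poly_quadratic L1 quad s0 (rootP s _).
rewrite eqxx orbT => /(_ isT) qs.
(* Both [r] and [s] are roots of [x^2 - a x + b], and they differ. *)
have aE : a = r + s.
  have : (r - s) * (r + s - a) = (r ^+ 2 - a * r + b) - (s ^+ 2 - a * s + b).
    by ring.
  rewrite qr qs subrr => /eqP.
  by rewrite mulf_eq0 !subr_eq0 (negbTE rs) => /eqP.
have bE : b = r * s.
  by rewrite -[b]subr0 -qr aE; ring.
rewrite {}aE {}bE in quad {qr qs}.
set L := laplacian e k in LT L1 quad chL e0E *; clearbody L.
(* Apply the quadratic relation to the constant vector. *)
have muv : mu%:Z * v%:Z = r * s.
  have /colP/(_ 0) := congr1 (fun X : 'M_n.+1 => X *m (const_mx 1 : 'cV_n.+1)) quad.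
  rewrite mulmxDl mulmxBl -mulmxA -scalemxAl L1 mulmx0 scaler0 subrr add0r.
  rewrite mul_scalar_mx !mxE mulr1 => ->.
  under eq_bigr => l _ do rewrite !mxE mulr1.
  by rewrite sumr_const card_ord nv -mulr_natr natz.
have L0 : L *m (L *m L - (r + s) *: L + (r * s)%:M) = 0.
  rewrite quad; have -> : const_mx mu%:Z
      = mu%:Z *: ((const_mx 1 : 'cV_n.+1) *m (const_mx 1 : 'rV_n.+1)).
    by apply/matrixP => i j; rewrite !mxE big_ord1 !mxE !mulr1.
  by rewrite -scalemxAr mulmxA L1 mul0mx scaler0.
have rankL q := mxrank_horner_0rs q r0 s0 rs f0 g0 chL L0.
have [U [W [d [Uu Wu LE]]]] := smith_diag L.
(* [L] has rational rank [f + g = n - 1], in the original [n]. *)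
have [j0 d_j0 d_neq0] : exists2 j0, d 0 j0 = 0 & forall j, j != j0 -> d 0 j != 0.
  have := rankL 'X; rewrite horner_mx_X !hornerX eqxx r0 s0 /= !muln1 add0n LE.
  rewrite (mxrank_map_smith _ _ Uu Wu); set A := [set j | _] => rk.
  have /eqP/cards1P[j0 E] : #|~: A| = 1%N.
    by have := cardsC A; rewrite card_ord; lia.
  have dE j : (d 0 j == 0) = (j == j0).
    by have /setP/(_ j) := E; rewrite !inE negbK intr_eq0.
  by exists j0 => [|j]; rewrite ?dE //; apply/eqP; rewrite dE.
have [r_gt0 logr] := pexact_logn p_pr pr.
have [s_gt0 logs] := pexact_logn p_pr ps.
have [_ logv] := pexact_logn p_pr pgam.
have prs : pexact p 3 `|(r * s)%R|.
  have -> : 3%N = logn p `|(r * s)%R| by rewrite abszM lognM // logr logs.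
  by apply: logn_pexact; rewrite // abszM muln_gt0 r_gt0.
rewrite LE in L1 LT quad chL e0E *.
have v_le3 := smith_logn_le3 p_pr Uu Wu d_j0 d_neq0 L1 quad prs.
have sumA := sum_card_smith_class d_j0 d_neq0 v_le3.
have logA := logn_prod_smith d_j0 d_neq0 v_le3.
(* Valuations of both sides of [prod_smith_invariants], with [q.[0] = (-r)^f (-s)^g]. *)
have sumE : (#|smith_class p d 1| + 2 * #|smith_class p d 2|
    + 3 * #|smith_class p d 3| + gam = f + 2 * g)%N.
  have := prod_smith_invariants Uu Wu d_j0 d_neq0 L1 LT
    (etrans chL (esym (mulrA _ _ _))).
  rewrite hornerM !horner_exp !hornerXsubC !sub0r abszM !abszX !abszN.
  move/(congr1 (logn p)); rewrite !lognM ?expn_gt0 ?r_gt0 ?s_gt0 //.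
    by rewrite !lognX logr logs logA (_ : logn p n.+1 = gam); [lia | rewrite nv].
  by rewrite absz_gt0; apply/prodf_neq0.
have e0A : e0 = #|smith_class p d 0| by rewrite e0E prank_smith.
have le1A := card_smith_le1 p d; have le1C := cardsC (smith_le1 p d).
rewrite card_ord in le1C.
have rank_Xsub x : horner_mx L ('X - x%:P) = L - x%:M.
  by rewrite rmorphB /= horner_mx_X horner_mx_C.
have f_le : (f <= #|smith_le1 p d|)%N.
  have [X XL] := saturated_left_kernel (intmul (1 : 'F_p)) (L - r%:M).
  rewrite -rank_Xsub rankL !hornerXsubC sub0r oppr_eq0 r0 subrr eqxx.
  rewrite subr_eq0 eq_sym rs muln0 addn0 muln1 => rkX.
  have <- : \rank (map_mx (intmul (1 : 'F_p)) X) = f by rewrite rkX; lia.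
  apply: (mxrank_eigen_le (U := U) p_pr Wu pr).
  by move/eqP: XL; rewrite mulmxBr mul_mx_scalar subr_eq0 LE => /eqP.
have g_le : (g <= #|~: smith_le1 p d|)%N.
  have [X XL] := saturated_left_kernel (intmul (1 : 'F_p)) (L - s%:M).
  rewrite -rank_Xsub rankL !hornerXsubC sub0r oppr_eq0 s0 subrr eqxx.
  rewrite subr_eq0 rs muln0 addn0 muln1 => rkX.
  have <- : \rank (map_mx (intmul (1 : 'F_p)) X) = g by rewrite rkX; lia.
  apply: (mxrank_dvd_le p_pr Uu Wu) => i j.
  move/eqP: XL; rewrite mulmxBr mul_mx_scalar subr_eq0 LE => /eqP->.
  by rewrite mxE dvdz_mulr // dvdzE absz_nat; case/andP: ps.
have g1_le : gam = 0%N -> (g < #|~: smith_le1 p d|)%N.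
  move=> gam0.
  have pmu : ((p ^ 3)%:Z %| mu%:Z)%Z.
    rewrite gam0 in pgam; apply: (pexact_dvdz_mul (x := v%:Z) p_pr pgam).
    by rewrite add0n mulrC muv dvdzE absz_nat; case/andP: prs.
  (* Including the kernel of [L] raises the dimension to [g + 1], which offsets the free column [j0]
     in the complement. *)
  have [X XL] := saturated_left_kernel (intmul (1 : 'F_p)) (L *m (L - s%:M)).
  have -> : L *m (L - s%:M) = horner_mx L ('X * ('X - s%:P)).
    by rewrite rmorphM /= horner_mx_X rank_Xsub.
  rewrite rankL !hornerM !hornerX !hornerXsubC mul0r subrr mulr0 eqxx.
  rewrite mulf_eq0 subr_eq0 (negbTE r0) (negbTE rs) /=.
  rewrite muln0 addn0 muln1 => rkX.
  have <- : \rank (map_mx (intmul (1 : 'F_p)) X) = g.+1 by rewrite rkX; lia.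
  apply: (mxrank_dvd_le p_pr Uu Wu) => i j; rewrite -LE.
  apply: (pexact_dvdz_mul (a := 1) p_pr pr).
  (* As [X L^2 = s X L], multiplying the quadratic relation by [X] gives [r X L = r s X - mu X J],
     whose right-hand side [p^3] divides. *)
  have -> : r * (X *m L) i j = (r * s) * X i j - (X *m const_mx mu%:Z) i j.
    have XLL : X *m L *m L = s *: (X *m L).
      apply/eqP; rewrite -subr_eq0 -mul_mx_scalar -mulmxBr -mulmxA.
      by rewrite XL.
    rewrite -LE in quad; rewrite -quad mulmxDr mulmxBr mulmxA XLL -scalemxAr.
    by rewrite mul_mx_scalar -scalerBl !mxE; ring.
  apply: rpredB; first by apply: dvdz_mulr; rewrite dvdzE absz_nat; case/andP: prs.
  by apply: dvdz_mulmx_l => a' b'; rewrite mxE.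
have iso := coker_ptorsion_smith p_pr Uu Wu v_le3.
have Kp a' b' c' : a' = #|smith_class p d 1|%:Z -> b' = #|smith_class p d 2|%:Z ->
    c' = #|smith_class p d 3|%:Z -> Kp_iso p (U *m diag_mx d *m W) a' b' c'.
  move=> -> -> ->.
  by exists #|smith_class p d 1|, #|smith_class p d 2|, #|smith_class p d 3|.
move: g1_le g_le f_le le1A le1C sumA sumE e0A nfg {iso} Kp; clear.
move: #|smith_class p d 0| #|smith_class p d 1| #|smith_class p d 2|.
move: #|smith_class p d 3| #|smith_le1 p d| #|~: smith_le1 p d|.
move=> a3 b1 b2 a0 a1 a2 g1_le g_le f_le bE bC sumA sumE e0E nE Kp.
(* Here [b1 = e_0 + e_1] is [f] or [f + 1], and it is [f] if [gam = 0]; the two linear relations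
   then determine [e_2] and [e_3]. *)
split=> [|gam0]; last by have g1 := g1_le gam0; apply: Kp; lia.
by have [le|gt] := leqP b1 f; [left|right]; apply: Kp; lia.
Qed.
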